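(* (Fixed target case.) Let $D'$ be a deck of $n\ge1$ cards (a dealing method; repeated values allowed), let $\mathcal O(D')$ be its set of reorderings and $N=\#\mathcal O(D')$. Then, as $a\to\infty$ through positive integers, the variation distance from uniform of the partition into hands obtained by an $a$-shuffle followed by dealing according to $D'$ satisfies $$\frac12\sum_{D\in\mathcal O(D')}\left|\mathbb{P}_a(D\to D')-\frac1N\right| = \overline{\kappa}_1(D')\,a^{-1}+O(a^{-2}),\qquad \overline{\kappa}_1(D')=\frac12\sum_{D\in\mathcal O(D')}|c_1(D,D')|.$$ Moreover, $$\overline{\kappa}_1(D')=\frac{n}{4N}\sum_{D\in\mathcal O(D')}|\theta(D)|,\qquad \theta(D)=\sum_{i=1}^{n-1}\frac{Z(D',D(i),D(i+1))}{n_{D(i)}\,n_{D(i+1)}}.$$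
   Context: A deck of $n$ cards is a function $D$ from $\{1,\dots,n\}$ to a finite totally ordered set of values (the order is arbitrary). A permutation $\pi\in S_n$ acts on decks by moving the card in position $i$ to position $\pi(i)$: $(\pi D)(\pi(i))=D(i)$. $\mathcal O(D')=\{\pi D':\pi\in S_n\}$. $n_v$ is the number of cards of value $v$ in $D'$. When $D'$ is a dealing method, the values are the players, $D'(j)$ is the player receiving the card in position $j$ of the shuffled deck, and $D\in\mathcal O(D')$ encodes the partition into hands in which $D(i)$ receives the card initially in position $i$; this partition occurs iff the shuffle takes $D$ to $D'$. For a positive integer $a$, the $a$-shuffle distribution on $S_n$ is $\mathbb{P}_a(\pi)=\frac1{a^n}\binom{a+n-\operatorname{des}(\pi)-1}{n}$, where $\operatorname{des}(\pi)=\#\{1\le i\le n-1:\pi(i)>\pi(i+1)\}$, and $\mathbb{P}_a(D\to D')=\sum_{\pi\in S_n:\ \pi D=D'}\mathbb{P}_a(\pi)$. A $u$-$v$ digraph in $D$ is an index $i$ with $D(i)=u$, $D(i+1)=v$. A $u$-$v$ pair in $D$ is a pair $(i,j)$ with $i<j$, $D(i)=u$, $D(j)=v$. Define $W(D,u,v)=\#\{u\text{-}v\text{ digraphs in }D\}-\#\{v\text{-}u\text{ digraphs in }D\}$, $Z(D,u,v)=\#\{u\text{-}v\text{ pairs in }D\}-\#\{v\text{-}u\text{ pairs in }D\}$ (so $Z(D,u,u)=0$), and for $D\in\mathcal O(D')$ $$c_1(D,D')=\frac{n}{2N}\sum_{u<v}\frac{W(D,u,v)Z(D',u,v)}{n_un_v},$$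 the sum being over pairs of values occurring in $D'$. *)

(* Defs.v *)
From HB Require Import structures.
From mathcomp Require Import all_boot all_order all_fingroup all_algebra.
From mathcomp Require Import all_classical all_reals all_analysis.

Set Implicit Arguments.
Unset Strict Implicit.
Unset Printing Implicit Defensive.

Import Order.TTheory GRing.Theory Num.Theory.
Import numFieldNormedType.Exports.

Local Open Scope ring_scope.

(* Positions 1..n are represented by 0..n-1, i.e. by 'I_n. *)
Notation deck n V := {ffun 'I_n -> V}.

Section Decks.
Context {d : Order.disp_t} {V : finOrderType d} {n : nat}.
Implicit Types (D : deck n V) (s : 'S_n) (u v : V).

Definition deck_act s D : deck n V := [ffun j => D (s^-1%g j)].

Lemma deck_actE s D i : deck_act s D (s i) = D i.
Proof. by rewrite ffunE permK. Qed.

Definition deck_orbit D : {set deck n V} := [set deck_act s D | s : 'S_n].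

Definition ncards D v : nat := #|[set i | D i == v]|.

Definition digraphs D u v : nat :=
  #|[set p : 'I_n * 'I_n | [&& p.2 == p.1.+1 :> nat, D p.1 == u & D p.2 == v]]|.

Definition upairs D u v : nat :=
  #|[set p : 'I_n * 'I_n | [&& (p.1 < p.2)%N, D p.1 == u & D p.2 == v]]|.

Definition Wdeck D u v : int := (digraphs D u v)%:Z - (digraphs D v u)%:Z.

Definition Zdeck D u v : int := (upairs D u v)%:Z - (upairs D v u)%:Z.

End Decks.

Definition des n (s : 'S_n) : nat :=
  #|[set p : 'I_n * 'I_n | (p.2 == p.1.+1 :> nat) && (s p.2 < s p.1)%N]|.

Section Shuffles.
Variable R : realType.

(* For 0 < a the truncated subtraction is exact, since des s <= n - 1. *)
Definition shuffle_prob n (a : nat) (s : 'S_n) : R :=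
  'C(a + n - des s - 1, n)%:R / a%:R ^+ n.

Context {d : Order.disp_t} {V : finOrderType d} {n : nat}.

Definition transition_prob (a : nat) (D D' : deck n V) : R :=
  \sum_(s : 'S_n | deck_act s D == D') shuffle_prob a s.

Definition variation_distance (a : nat) (D' : deck n V) : R :=
  2^-1 * \sum_(D in deck_orbit D')
    `|transition_prob a D D' - #|deck_orbit D'|%:R^-1|.

Definition c1 (D D' : deck n V) : R :=
  n%:R / (2 * #|deck_orbit D'|%:R) *
  \sum_(u in codom D') \sum_(v in codom D' | (u < v)%O)
    (Wdeck D u v)%:~R * (Zdeck D' u v)%:~R /
    ((ncards D' u)%:R * (ncards D' v)%:R).

Definition kappa1 (D' : deck n V) : R :=
  2^-1 * \sum_(D in deck_orbit D') `|c1 D D'|.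

(* The inner sum has the single term j = i + 1, and is empty when i is the last
   position. *)
Definition theta (D' D : deck n V) : R :=
  \sum_(i < n) \sum_(j < n | j == i.+1 :> nat)
    (Zdeck D' (D i) (D j))%:~R /
    ((ncards D' (D i))%:R * (ncards D' (D j))%:R).

End Shuffles.

(* Main.v *)
(** The probability of a permutation is a polynomial in 1/a,
    P_a(s) = (1/n!) prod_(k < n) (1 + (n - 1 - des s - k)/a),
    with linear coefficient n ((n - 1)/2 - des s) / n!.  Write (n - 1)/2 - des s
    as half the sum over i of the sign of s(i + 1) - s(i), and sum over the
    permutations s taking D to D'.  If D(i) <> D(i + 1), then (s(i), s(i + 1)) is
    equidistributed over the pairs of positions of D' with these two values, so
    the mean sign is Z / (n_u n_v); if D(i) = D(i + 1), the signs cancel.  Hence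
    the linear coefficient of P_a(D -> D') is n theta(D) / (2 N), and collecting
    the positions i according to {D(i), D(i + 1)} identifies it with c_1. *)

Require Import Defs.
From mathcomp Require Import all_boot all_order all_fingroup all_algebra.
From mathcomp Require Import all_classical all_reals all_analysis.
From mathcomp Require Import zify ring lra.
Import Order.TTheory GRing.Theory Num.Theory.
Import numFieldNormedType.Exports.
Set Implicit Arguments.
Unset Strict Implicit.
Unset Printing Implicit Defensive.

Local Open Scope classical_set_scope.
Local Open Scope ring_scope.

(** * First-order expansion of finite products *)

Lemma prod1D_expansion (R : realDomainType) (I : Type) (r : seq I) (b : I -> R) :
  exists C, forall x, 0 <= x <= 1 ->
    `|\prod_(i <- r) (1 + b i * x) - 1 - (\sum_(i <- r) b i) * x| <= C * x ^+ 2.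
Proof.
elim: r => [|i r [C IH]].
  by exists 0 => x _; rewrite !big_nil !mul0r subrr subr0 normr0.
(* The new remainder is [b i * S * x ^+ 2] plus [1 + b i * x] times the old remainder, and [x <= 1]
   bounds that factor by [1 + |b i|]. *)
exists (`|b i * \sum_(j <- r) b j| + (1 + `|b i|) * C) => x x01.
have := IH x x01; rewrite !big_cons.
set P := \prod_(j <- r) _; set S := \sum_(j <- r) _ => IHx.
have [x0 x1] := andP x01.
have -> : (1 + b i * x) * P - 1 - (b i + S) * x =
  b i * S * x ^+ 2 + (1 + b i * x) * (P - 1 - S * x) by ring.
apply: le_trans (ler_normD _ _) _; rewrite [leRHS]mulrDl.
apply: lerD; first by rewrite [leLHS]normrM (ger0_norm (sqr_ge0 x)).
rewrite normrM -mulrA; apply: ler_pM => //.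
apply: le_trans (ler_normD _ _) _; rewrite normr1 normrM (ger0_norm x0) lerD2l.
by rewrite ler_piMr.
Qed.

(** * Error terms of order a^-2 *)

Section InverseSquare.
Variable R : realType.
Implicit Types f g : nat -> R.

(** An explicit form of O(a^-2): closure under domination and finite sums is then elementary, and
    [inv_sq_bounded_eqO] converts to Landau notation at the very end. *)
Definition inv_sq_bounded f :=
  exists C N, forall a, (N <= a)%N -> `|f a| <= C * a%:R ^- 2.

Lemma inv_sq_bounded_le f g : (forall a, `|f a| <= `|g a|) ->
  inv_sq_bounded g -> inv_sq_bounded f.
Proof. by move=> fg [C [N gC]]; exists C, N => a /gC; exact: le_trans. Qed.

Lemma inv_sq_bounded_sum (I : Type) (r : seq I) (P : pred I) (F : I -> nat -> R) :
  (forall i, P i -> inv_sq_bounded (F i)) ->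
  inv_sq_bounded (fun a => \sum_(i <- r | P i) F i a).
Proof.
move=> FO; elim: r => [|i r [C [N IH]]].
  by exists 0, 0%N => a _; rewrite big_nil normr0 mul0r.
case Pi: (P i); last by exists C, N => a /IH; rewrite big_cons Pi.
have [Ci [Ni Fi]] := FO _ Pi.
exists (Ci + C), (maxn Ni N) => a; rewrite geq_max => /andP[/Fi h1 /IH h2].
by rewrite big_cons Pi mulrDl (le_trans (ler_normD _ _))// lerD.
Qed.

Lemma inv_sq_bounded_eqO f g : inv_sq_bounded (f \- g) ->
  f = g +O_\oo (fun a : nat => a%:R ^- 2 : R).
Proof.
move=> [C [N fgC]]; apply/eqaddOP; near=> k; near=> a.
rewrite /= (le_trans (fgC a _))//; first by near: a; exact: nbhs_infty_ge.
rewrite normrV ?unitfE ?normrX ?normr_nat; last first.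
  by rewrite expf_neq0// pnatr_eq0 -lt0n; near: a; exact: nbhs_infty_gt.
by rewrite ler_wpM2r// invr_ge0 exprn_ge0.
Unshelve. all: by end_near.
Qed.

End InverseSquare.

(** * Expansion of the probability of a single permutation *)

Section Shuffle.
Variables (R : realType) (n : nat).
Implicit Types (i j p q : 'I_n) (s : 'S_n).

(** The sign of q - p, equal to 0 when p = q. *)
Definition order_sign p q : R := (p < q)%N%:R - (q < p)%N%:R.

Lemma order_signC p q : order_sign q p = - order_sign p q.
Proof. by rewrite opprB. Qed.

Lemma sum_succ_ord (F : 'I_n -> 'I_n -> R) :
  \sum_(i < n) \sum_(j < n | j == i.+1 :> nat) F i j =
  \sum_(p : 'I_n * 'I_n | p.2 == p.1.+1 :> nat) F p.1 p.2.
Proof. by rewrite pair_big_dep. Qed.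

Lemma desE s :
  (des s)%:R = \sum_(p : 'I_n * 'I_n | p.2 == p.1.+1 :> nat)
                 (s p.2 < s p.1)%N%:R :> R.
Proof.
rewrite /des cardsE -sum1_card natr_sum big_mkcondr /=.
by apply: eq_bigr => p _; case: ifP.
Qed.

Lemma sum_succ_ord1 : (0 < n)%N ->
  \sum_(p : 'I_n * 'I_n | p.2 == p.1.+1 :> nat) 1 = n%:R - 1 :> R.
Proof.
rewrite -(sum_succ_ord (fun _ _ => 1)).
(* The last position has no successor, so its inner sum is empty. *)
case: n => // m _; rewrite big_ord_recr /= [X in _ + X]big_pred0 => [|j]; last first.
  by apply/negbTE; rewrite neq_ltn ltn_ord.
rewrite addr0 -natr1 addrK -[in RHS](card_ord m) -sum1_card natr_sum.
by apply: eq_bigr => i _; rewrite (big_pred1 (lift ord0 i)).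
Qed.

(** As s is injective, each adjacent pair contributes 1 at an ascent and -1 at a descent, that is, 1
    minus twice the descent indicator. *)
Lemma sum_order_sign_des s : (0 < n)%N ->
  \sum_(p : 'I_n * 'I_n | p.2 == p.1.+1 :> nat) order_sign (s p.1) (s p.2) =
  n%:R - 1 - 2 * (des s)%:R.
Proof.
move=> n0; rewrite -sum_succ_ord1 // desE mulr_sumr -sumrB.
apply: eq_bigr => -[i j] /= /eqP ji.
have: s i != s j by rewrite (inj_eq perm_inj) -val_eqE /= ji neq_ltn ltnSn.
by rewrite /order_sign -val_eqE /=; case: ltngtP => //= _ _; ring.
Qed.

Lemma shuffle_prob_expansion s :
  inv_sq_bounded (fun a => shuffle_prob R a s -
    (n`!%:R^-1 + n%:R / n`!%:R * ((n%:R - 1) / 2 - (des s)%:R) / a%:R)).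
Proof.
pose b (k : 'I_n) : R := n%:R - 1 - (des s)%:R - k%:R.
have sumb : \sum_k b k = n%:R * ((n%:R - 1) / 2 - (des s)%:R).
  have sumk m : \sum_(k < m) k%:R = m%:R * (m%:R - 1) / 2 :> R.
    by elim: m => [|m IH]; rewrite ?big_ord0 ?mul0r// big_ord_recr /= IH -natr1; field.
  by rewrite sumrB sumr_const card_ord sumk -mulr_natl; field.
have [C bC] := prod1D_expansion (index_enum 'I_n) b.
have f0 : n`!%:R != 0 :> R by rewrite pnatr_eq0 -lt0n fact_gt0.
(* Beyond this threshold a is nonzero and the truncated subtractions in [a + n - des s - 1 - k] are
   exact for all k < n. *)
exists (n`!%:R^-1 * C), (des s + n).+1 => a aN.
have a0 : (0 < a)%N by exact: leq_ltn_trans aN.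
have aR0 : a%:R != 0 :> R by rewrite pnatr_eq0 -lt0n.
have a01 : 0 <= (a%:R^-1 : R) <= 1.
  by rewrite invr_ge0 ler0n invf_le1 ?ltr0n ?ler1n.
(* Times n!, the binomial coefficient is a falling factorial; dividing each of its n factors by a
   gives [1 + b k / a]. *)
have -> : shuffle_prob R a s = n`!%:R^-1 * \prod_k (1 + b k * a%:R^-1).
  rewrite /shuffle_prob -[X in _%:R / X](mulfK f0) -mulrA.
  apply: (mulfI f0); rewrite mulVKf //.
  have -> : \prod_k (1 + b k * a%:R^-1) =
      (\prod_(k < n) (a + n - des s - 1 - k)%:R) / a%:R ^+ n.
    rewrite -[in a%:R ^+ n](card_ord n) -prodr_const -prodf_div.
    apply: eq_bigr => k _; rewrite -!subnDA natrB ?natrD /b; first by field.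
    by have := ltn_ord k; lia.
  rewrite -natr_prod -ffact_prod -bin_ffact natrM; field.
  by rewrite expf_neq0.
rewrite [X in `|X|](_ : _ = n`!%:R^-1 * (\prod_k (1 + b k * a%:R^-1) - 1 -
  (\sum_k b k) * a%:R^-1)); last by rewrite sumb; field; rewrite ?aR0 ?f0.
rewrite normrM ger0_norm ?invr_ge0 ?ler0n// -mulrA ler_wpM2l ?invr_ge0 ?ler0n//.
by rewrite -exprVn bC.
Qed.

End Shuffle.

(** * Sums over the permutations taking one deck to another *)

Section Transport.
Variables (R : realType) (d : Order.disp_t) (V : finOrderType d) (n : nat).
Implicit Types (D : deck n V) (i j p q : 'I_n) (s t : 'S_n) (u v : V).

Lemma deck_actP D D' s :
  reflect (forall i, D' (s i) = D i) (deck_act s D == D').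
Proof.
apply: (iffP eqP) => [<- i|DD']; first exact: deck_actE.
by apply/ffunP => j; rewrite ffunE -DD' permKV.
Qed.

Lemma deck_act_neq0 D D' s i : deck_act s D == D' -> (ncards D' (D i))%:R != 0 :> R.
Proof.
move=> /deck_actP DD'; rewrite pnatr_eq0 -lt0n; apply/card_gt0P.
by exists (s i); rewrite inE DD'.
Qed.

Lemma ncardsE D v : (ncards D v)%:R = \sum_(p | D p == v) 1 :> R.
Proof. by rewrite /ncards cardsE -sum1_card natr_sum. Qed.

(** Orbit-stabilizer: the fibre of [s |-> deck_act s^-1 D'] over a deck of the orbit is the set of
    permutations taking that deck to D', and left translation by t identifies the fibre over
    [deck_act t D'] with the stabilizer of D'. *)
Lemma card_transporter D D' : D \in deck_orbit D' ->
  (#|deck_orbit D'| * #|[pred s | deck_act s D == D']| = n`!)%N.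
Proof.
have key t : #|[pred s | deck_act s (deck_act t D') == D']| =
             #|[pred s | deck_act s D' == D']|.
  rewrite -[LHS](fintype.card_image (mulgI t)); apply: eq_card => s.
  apply/fintype.imageP/idP => [[r /deck_actP rt ->]|/deck_actP st].
    by apply/deck_actP => i; rewrite permM rt deck_actE.
  exists (t^-1 * s)%g; last by rewrite mulKVg.
  by apply/deck_actP => i; rewrite permM st ffunE.
move=> /imsetP[t0 _ ->]; rewrite key -card_Sn -[in RHS]sum1_card.
rewrite (partition_big (fun s => deck_act s^-1%g D') (mem (deck_orbit D'))) /=;
  last by move=> s _; apply/imsetP; exists s^-1%g.
rewrite -sum_nat_const; apply: eq_bigr => _ /imsetP[t _ ->].
rewrite -(key t) -sum1_card; apply: eq_bigl => s; rewrite !inE.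
apply/deck_actP/eqP => [st|ts i].
  by apply/ffunP => i; rewrite -st ffunE invgK.
by rewrite -ts ffunE invgK.
Qed.

(* Composing s with the transposition of two positions p, q of D' of value D i
   exchanges the events s i = p and s i = q, and fixes s j as D j <> D i. *)
Lemma transport_sum_swap D D' i j (f : 'I_n -> 'I_n -> R) : D i != D j ->
  (ncards D' (D i))%:R * \sum_(s | deck_act s D == D') f (s i) (s j) =
  \sum_(s | deck_act s D == D') \sum_(p | D' p == D i) f p (s j).
Proof.
move=> Dij; rewrite exchange_big /= ncardsE mulr_suml.
have part g : \sum_(s | deck_act s D == D') g s = \sum_(q | D' q == D i)
    \sum_(s | (deck_act s D == D') && (s i == q)) g s :> R.
  by apply: partition_big => s /deck_actP ->.
under [LHS]eq_bigr do rewrite mul1r part.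
under [RHS]eq_bigr do rewrite part.
rewrite exchange_big /=; apply: eq_bigr => p Dp; apply: eq_bigr => q Dq.
rewrite (reindex_inj (mulIg (tperm p q))) /=.
have inv x : D' (tperm p q x) = D' x.
  by case: tpermP => // ->; rewrite (eqP Dp) (eqP Dq).
apply: eq_big => [s|s].
  congr andb; last by rewrite permM (canF_eq (tpermK p q)) tpermL.
  by apply/deck_actP/deck_actP => H x; rewrite -H permM inv.
rewrite permM => /andP[/deck_actP Ts sip].
rewrite permM (eqP sip); congr (f _ _).
have DTs x : D' (s x) = D x by rewrite -Ts permM inv.
by apply: tpermD; apply: contraNneq Dij => e; rewrite -[D j]DTs -e ?(eqP Dp) ?(eqP Dq).
Qed.

Lemma Zdeck_sum D u v : (Zdeck D u v)%:~R =
  \sum_(p | D p == u) \sum_(q | D q == v) order_sign R p q.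
Proof.
have up (a b : V) : (upairs D a b)%:R =
    \sum_(p | D p == a) \sum_(q | D q == b) (p < q)%N%:R :> R.
  rewrite /upairs cardsE -sum1_card natr_sum pair_big /=.
  rewrite [RHS](bigID (fun p : 'I_n * 'I_n => (p.1 < p.2)%N)) /=.
  rewrite [X in _ + X]big1 ?addr0 => [|p /andP[_ /negbTE->]] //.
  by apply: eq_big => [p|p /andP[-> _]] //; rewrite andbC.
rewrite /Zdeck intrB -!pmulrn !up [X in _ - X]exchange_big /= -sumrB.
by apply: eq_bigr => p _; rewrite -sumrB.
Qed.

Lemma Zdeckxx D u : Zdeck D u u = 0.
Proof. exact: subrr. Qed.

Lemma ZdeckC D u v : Zdeck D v u = - Zdeck D u v.
Proof. by rewrite opprB. Qed.

Lemma transport_order_sign D D' i j : (exists s, deck_act s D == D') -> i != j ->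
  \sum_(s | deck_act s D == D') order_sign R (s i) (s j) =
  #|[pred s | deck_act s D == D']|%:R * ((Zdeck D' (D i) (D j))%:~R /
    ((ncards D' (D i))%:R * (ncards D' (D j))%:R)).
Proof.
move=> [s0 Ts0] ij; have [Dij|Dij] := eqVneq (D i) (D j).
  rewrite Dij Zdeckxx mul0r mulr0; set S := \sum_(_ | _) _.
  (* Precomposing s with the transposition of i and j, which preserves D, reverses every sign. *)
  suff : S = - S by lra.
  rewrite /S -[RHS]sumrN [LHS](reindex_inj (mulgI (tperm i j))) /=.
  apply: eq_big => [s|s _]; last by rewrite !permM tpermL tpermR order_signC.
  have inv x : D (tperm i j x) = D x by case: tpermP => // ->.
  apply/deck_actP/deck_actP => H x; last by rewrite permM H inv.
  by rewrite -inv -H permM tpermK.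
have ni := deck_act_neq0 i Ts0; have nj := deck_act_neq0 j Ts0.
apply: (mulfI nj); apply: (mulfI ni).
(* Exchange first [s i], then [s j], for free positions p, q of the two values. The summand no
   longer depends on s, so the double sum is Z, counted once per transporting permutation. *)
rewrite mulrCA transport_sum_swap // exchange_big /= mulr_sumr.
under eq_bigr => p _ do
  rewrite (transport_sum_swap D' (fun q _ => order_sign R p q) (i := j) (j := i)) 1?eq_sym //
          sumr_const.
rewrite sumrMnl -mulr_natl Zdeck_sum; field.
by rewrite ni nj.
Qed.

(** * The identity between [c1] and [theta] *)

Lemma sum_antisym_pairs (G : V -> V -> R) : (forall u, G u u = 0) ->
  \sum_u \sum_v G u v = \sum_u \sum_(v | (u < v)%O) (G u v + G v u).
Proof.
move=> G0; under [RHS]eq_bigr do rewrite big_split.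
rewrite [RHS]big_split /= [X in _ + X](exchange_big_dep predT) //= -big_split /=.
apply: eq_bigr => u _; rewrite (bigID (fun v => (u < v)%O)) /=; congr (_ + _).
rewrite (bigD1 u) ?ltxx //= G0 add0r; apply: eq_bigl => v.
by rewrite -leNgt lt_neqAle andbC.
Qed.

Lemma c1_theta D D' :
  c1 R D D' = n%:R / (2 * #|deck_orbit D'|%:R) * theta R D' D.
Proof.
rewrite /c1; congr (_ * _).
pose F u v : R := (Zdeck D' u v)%:~R / ((ncards D' u)%:R * (ncards D' v)%:R).
have FC u v : F v u = - F u v by rewrite /F ZdeckC rmorphN mulNr [X in _ / X]mulrC.
(* For a value absent from D' the denominator of F is 0, so F vanishes by the convention on division
   by zero; this lets sums over all of V be cut down to [codom D']. *)
have n0 u : u \notin codom D' -> (ncards D' u)%:R = 0 :> R.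
  move=> uD; rewrite /ncards eq_card0 // => i; rewrite !inE.
  by apply: contraNF uD => /eqP <-; exact: codom_f.
(* Group adjacent positions by the ordered pair of their values; antisymmetry of F will then turn
   the digraph counts into W. *)
have -> : theta R D' D = \sum_u \sum_v (digraphs D u v)%:R * F u v.
  rewrite /theta (sum_succ_ord (fun i j => F (D i) (D j))).
  rewrite (partition_big (fun p : 'I_n * 'I_n => D p.1) predT) //=; apply: eq_bigr => u _.
  rewrite (partition_big (fun p : 'I_n * 'I_n => D p.2) predT) //=; apply: eq_bigr => v _.
  rewrite /digraphs cardsE -sum1_card natr_sum mulr_suml.
  apply: eq_big => [p|p /andP[/andP[_ /eqP->] /eqP->]]; last by rewrite mul1r.
  by rewrite -andbA.
rewrite sum_antisym_pairs => [|u]; last by rewrite /F Zdeckxx mul0r mulr0.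
rewrite [RHS](bigID (mem (codom D'))) /= [X in _ + X]big1 ?addr0 => [|u uD]; last first.
  by apply: big1 => v _; rewrite /F (n0 u uD) mul0r mulr0 invr0 !mulr0 addr0.
apply: eq_bigr => u _; rewrite [RHS](bigID (mem (codom D'))) /=.
rewrite [X in _ + X]big1 ?addr0 => [|v /andP[_ vD]]; last first.
  by rewrite /F (n0 v vD) mul0r mulr0 invr0 !mulr0 addr0.
apply: eq_big => [v|v _]; first by rewrite andbC.
by rewrite (FC u v) /Wdeck intrB -!pmulrn /F; ring.
Qed.

Lemma transition_prob_expansion D D' : (0 < n)%N -> D \in deck_orbit D' ->
  inv_sq_bounded (fun a => transition_prob R a D D' -
    (#|deck_orbit D'|%:R^-1 + c1 R D D' / a%:R)).
Proof.
move=> n_gt0 DD'.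
have nT := card_transporter DD'; set T := [pred s | _] in nT.
have exT : exists s, deck_act s D == D'.
  have /imsetP[t _ ->] := DD'; exists t^-1%g; apply/deck_actP => i.
  by rewrite ffunE.
have f0 : n`!%:R != 0 :> R by rewrite pnatr_eq0 -lt0n fact_gt0.
have nTR : #|deck_orbit D'|%:R * #|T|%:R = n`!%:R :> R by rewrite -natrM nT.
have N0 : #|deck_orbit D'|%:R != 0 :> R.
  by apply: contraNneq f0 => N0; rewrite -nTR N0 mul0r.
have T0 : #|T|%:R != 0 :> R.
  by apply: contraNneq f0 => T0; rewrite -nTR T0 mulr0.
(* Each centred descent number is half a sum of adjacent signs; exchanging the sums lets
   [transport_order_sign] evaluate each adjacent pair. *)
have sum_des : \sum_(s | T s) ((n%:R - 1) / 2 - (des s)%:R) =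
    #|T|%:R / 2 * theta R D' D.
  transitivity (2^-1 * \sum_(s | T s)
      \sum_(p : 'I_n * 'I_n | p.2 == p.1.+1 :> nat) order_sign R (s p.1) (s p.2)).
    rewrite mulr_sumr; apply: eq_bigr => s _.
    by rewrite sum_order_sign_des //; field.
  rewrite exchange_big /= /theta.
  rewrite (sum_succ_ord (fun i j => (Zdeck D' (D i) (D j))%:~R /
    ((ncards D' (D i))%:R * (ncards D' (D j))%:R))).
  rewrite [#|T|%:R / 2]mulrC -mulrA; congr (_ * _); rewrite mulr_sumr.
  apply: eq_bigr => -[i j] /= /eqP ji; apply: transport_order_sign => //.
  by rewrite -val_eqE /= ji neq_ltn ltnSn.
apply: (inv_sq_bounded_le (g := fun a => \sum_(s | T s) (shuffle_prob R a s -
    (n`!%:R^-1 + n%:R / n`!%:R * ((n%:R - 1) / 2 - (des s)%:R) / a%:R)))).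
  (* The two sides are in fact equal: [nTR] turns the constant term |T|/n! into 1/N, and [sum_des]
     gives the linear term. *)
  move=> a; rewrite sumrB /transition_prob.
  rewrite le_eqVlt; apply/orP; left; apply/eqP; congr `|_ - _|.
  rewrite big_split /= -mulr_suml -mulr_sumr sum_des sumr_const -mulr_natl.
  rewrite -/T -nTR c1_theta; congr (_ + _ / _); field; by rewrite ?N0 ?T0.
by apply: inv_sq_bounded_sum => s _; exact: shuffle_prob_expansion.
Qed.

End Transport.

Theorem mainTheorem5 (R : realType) (d : Order.disp_t) (V : finOrderType d)
    (n : nat) (hn : (0 < n)%N) (D' : deck n V) :
  (fun a : nat => variation_distance R a D') =
    (fun a : nat => kappa1 R D' * a%:R^-1) +O_\oo (fun a : nat => a%:R ^- 2 : R) /\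
  kappa1 R D' =
    n%:R / (4 * #|deck_orbit D'|%:R) *
    \sum_(D in deck_orbit D') `|theta R D' D|.
Proof.
split; last first.
  rewrite /kappa1 !mulr_sumr; apply: eq_bigr => D DD'.
  rewrite c1_theta normrM ger0_norm ?divr_ge0 ?mulr_ge0 //.
  rewrite mulrA; congr (_ * _); field.
  by rewrite pnatr_eq0 -lt0n; apply/card_gt0P; exists D.
apply: inv_sq_bounded_eqO; apply: (inv_sq_bounded_le (g := fun a =>
  \sum_(D in deck_orbit D') `|transition_prob R a D D' -
    (#|deck_orbit D'|%:R^-1 + c1 R D D' / a%:R)|)).
  (* Termwise reverse triangle inequality between P - 1/N and c1/a, after bounding the prefactor 1/2
     by 1. *)
  move=> a; rewrite /= /variation_distance /kappa1 -mulrA -mulrBr mulr_suml -sumrB.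
  rewrite normrM ger0_norm ?invr_ge0 // [leRHS]ger0_norm ?sumr_ge0 //.
  rewrite (le_trans (ler_piMl _ _)) ?invf_le1 ?ler1n //.
  rewrite (le_trans (ler_norm_sum _ _ _)) //; apply: ler_sum => D _.
  rewrite -[a%:R^-1 in leLHS]ger0_norm ?invr_ge0 // -normrM opprD addrA.
  exact: ler_dist_dist.
apply: inv_sq_bounded_sum => D DD'.
apply: inv_sq_bounded_le _ (transition_prob_expansion R hn DD') => a.
by rewrite normr_id.
Qed.
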